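(* Let $G:G_1\overset{d_G}{\longrightarrow}G_0$ and $H:H_1\overset{d_H}{\longrightarrow}H_0$ be two finite isoclinic crossed modules (finite meaning that $G_1,G_0,H_1,H_0$ are finite groups). Then their class preserving actors are isomorphic crossed modules: $Act_{\mathcal C}(G)\cong Act_{\mathcal C}(H)$.
   Context: A crossed module $G:G_1\overset{d_G}{\longrightarrow}G_0$ is a group homomorphism $d_G:G_1\to G_0$ together with a left action of $G_0$ on $G_1$ by automorphisms, written ${}^{g_0}g_1$, such that $d_G({}^{g_0}g_1)=g_0d_G(g_1)g_0^{-1}$ and ${}^{d_G(g_1)}g_1'=g_1g_1'g_1^{-1}$. A morphism from $G$ to $G':G_1'\overset{d'}{\longrightarrow}G_0'$ is a pair $(\alpha,\beta)$ of group homomorphisms $\alpha:G_1\to G_1'$, $\beta:G_0\to G_0'$ with $\beta d_G=d'\alpha$ and $\alpha({}^{g_0}g_1)={}^{\beta(g_0)}\alpha(g_1)$; it is an isomorphism if both components are bijective. $Aut(G)$ is the group of automorphisms of $G$ under componentwise composition. Put $G_1^{G_0}=\{g_1\in G_1:{}^{g_0}g_1=g_1\ \forall g_0\in G_0\}$, $St_{G_0}(G_1)=\{g_0\in G_0:{}^{g_0}g_1=g_1\ \forall g_1\in G_1\}$, and let $D_{G_0}(G_1)$ be the subgroup of $G_1$ generated by all ${}^{g_0}g_1g_1^{-1}$. The center of $G$ is $Z(G):G_1^{G_0}\to St_{G_0}(G_1)\cap Z(G_0)$ and the commutator subcrossed module is $[G,G]:D_{G_0}(G_1)\to[G_0,G_0]$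 (maps and actions restricted from $G$). The quotient $G/Z(G)$ is the crossed module $\overline{G_1}\to\overline{G_0}$ with induced map and action, where $\overline{G_1}=G_1/G_1^{G_0}$, $\overline{G_0}=G_0/(St_{G_0}(G_1)\cap Z(G_0))$. There are well-defined maps $c_1^G:\overline{G_1}\times\overline{G_0}\to D_{G_0}(G_1)$, $(\overline{g_1},\overline{g_0})\mapsto{}^{g_0}g_1g_1^{-1}$, and $c_0^G:\overline{G_0}\times\overline{G_0}\to[G_0,G_0]$, $(\overline{g_0},\overline{g_0'})\mapsto[g_0,g_0']=g_0g_0'g_0^{-1}g_0'^{-1}$. Crossed modules $G$ and $H$ are isoclinic if there exist crossed module isomorphisms $(\eta_1,\eta_0):G/Z(G)\to H/Z(H)$ and $(\xi_1,\xi_0):[G,G]\to[H,H]$ such that $\xi_1\circ c_1^G=c_1^H\circ(\eta_1\times\eta_0)$ and $\xi_0\circ c_0^G=c_0^H\circ(\eta_0\times\eta_0)$. A derivation is a map $\partial:G_0\to G_1$ with $\partial(xy)=\partial(x)\,{}^{x}\partial(y)$ for all $x,y\in G_0$. The set of derivations is a monoid under $(\partial_1\circ\partial_2)(g_0)=\partial_1\big(d_G\partial_2(g_0)\,g_0\big)\,\partial_2(g_0)$, with identity the trivial map; the Whitehead group $D(G_0,G_1)$ is its group of units. The actor of $G$ is the crossed module $\Delta:D(G_0,G_1)\to Aut(G)$, where $\Delta(\partial)$ is the pair consisting of $g_1\mapsto\partial(d_G(g_1))\,g_1$ and $g_0\mapsto d_G(\partial(g_0))\,g_0$, with action ${}^{(\alpha,\beta)}\partial=\alpha\partial\beta^{-1}$.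 $D_{\mathcal C}(G_0,G_1)$ is the subgroup of those $\delta\in D(G_0,G_1)$ for which there exists $g_1\in G_1$ such that $\delta(g_0)=g_1\,{}^{g_0}g_1^{-1}$ for all $g_0\in G_0$. $Aut_{\mathcal C}(G)$ is the subgroup of those $(\alpha,\beta)\in Aut(G)$ for which there exists $g_0\in G_0$ such that $\alpha(g_1)={}^{g_0}g_1$ and $\beta(g_0')=g_0g_0'g_0^{-1}$ for all $g_1\in G_1$, $g_0'\in G_0$. The class preserving actor $Act_{\mathcal C}(G):D_{\mathcal C}(G_0,G_1)\to Aut_{\mathcal C}(G)$ is the crossed module obtained by restricting $\Delta$ and the action. *)

(* Defs.v *)
From HB Require Import structures.
From mathcomp Require Import all_boot all_fingroup.
From mathcomp Require Import center.

Set Implicit Arguments.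
Unset Strict Implicit.
Unset Printing Implicit Defensive.

Local Open Scope group_scope.

(* Finite crossed modules bnd : grp1 -> grp0; lact x u is the left action of
   x on u (the actions of mathcomp.fingroup.action are right actions). *)
Record crossed_module := CrossedModule {
  grp1 : finGroupType;
  grp0 : finGroupType;
  bnd : grp1 -> grp0;
  lact : grp0 -> grp1 -> grp1;
  bndM : {morph bnd : u v / u * v};
  lact1 : forall u, lact 1 u = u;
  lactM : forall x y u, lact (x * y) u = lact x (lact y u);
  lact_morph : forall x, {morph lact x : u v / u * v};
  bnd_lact : forall x u, bnd (lact x u) = x * bnd u * x^-1;
  lact_bnd : forall u v, lact (bnd u) v = u * v * u^-1
}.
Arguments bnd {_}.
Arguments lact {_}.

Section Basics.
Variable G : crossed_module.
Implicit Types (x y : grp0 G) (u v : grp1 G).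

Lemma bnd1 : bnd (1 : grp1 G) = 1.
Proof. by apply: (mulgI (bnd 1)); rewrite -bndM !mulg1. Qed.

Lemma bndV u : bnd u^-1 = (bnd u)^-1.
Proof. by apply: (mulgI (bnd u)); rewrite -bndM !mulgV bnd1. Qed.

Lemma lactg1 x : lact x (1 : grp1 G) = 1.
Proof. by apply: (mulgI (lact x 1)); rewrite -lact_morph !mulg1. Qed.

Lemma lactV x u : lact x u^-1 = (lact x u)^-1.
Proof. by apply: (mulgI (lact x u)); rewrite -lact_morph !mulgV lactg1. Qed.

Lemma lactK x : cancel (@lact G x) (lact x^-1).
Proof. by move=> u; rewrite -lactM mulVg lact1. Qed.

Lemma lactVK x : cancel (@lact G x^-1) (lact x).
Proof. by move=> u; rewrite -lactM mulgV lact1. Qed.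

End Basics.

(* Boolean, so that it can carve out Aut(G) as a finite type. *)
Definition crossed_morphism (G H : crossed_module)
    (f1 : grp1 G -> grp1 H) (f0 : grp0 G -> grp0 H) : bool :=
  [&& [forall u, forall v, f1 (u * v) == f1 u * f1 v],
      [forall x, forall y, f0 (x * y) == f0 x * f0 y],
      [forall u, f0 (bnd u) == bnd (f1 u)]
    & [forall x, forall u, f1 (lact x u) == lact (f0 x) (f1 u)]].

Lemma crossed_morphismP G H f1 f0 :
  reflect [/\ {morph f1 : u v / u * v}, {morph f0 : x y / x * y},
              forall u, f0 (bnd u) = bnd (f1 u)
            & forall x u, f1 (lact x u) = lact (f0 x) (f1 u)]
          (@crossed_morphism G H f1 f0).
Proof.
apply: (iffP and4P) => [[/forallP m1 /forallP m0 /forallP fd /forallP fa] |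
                        [m1 m0 fd fa]].
- split=> [u v|x y|u|x u]; apply/eqP; by
    [exact: (forallP (m1 u)) | exact: (forallP (m0 x)) | | exact: (forallP (fa x))].
- split; apply/forallP => a; rewrite ?fd //; apply/forallP => b.
  + by rewrite m1.
  + by rewrite m0.
  + by rewrite fa.
Qed.

Definition crossed_iso (G H : crossed_module)
    (f1 : grp1 G -> grp1 H) (f0 : grp0 G -> grp0 H) : Prop :=
  [/\ crossed_morphism f1 f0, bijective f1 & bijective f0].

Definition isomorphic (G H : crossed_module) : Prop :=
  exists (f1 : grp1 G -> grp1 H) (f0 : grp0 G -> grp0 H), crossed_iso f1 f0.

Record subcrossed (G : crossed_module) := Subcrossed {
  sub1 : {group grp1 G};
  sub0 : {group grp0 G};
  sub_bnd : forall u, u \in sub1 -> bnd u \in sub0;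
  sub_lact : forall x u, x \in sub0 -> u \in sub1 -> lact x u \in sub1
}.

Section SubCrossedModule.
Variables (G : crossed_module) (S : subcrossed G).
Local Notation S1 := (subg_of (sub1 S)).
Local Notation S0 := (subg_of (sub0 S)).

Definition sbnd (u : S1) : S0 := Subg (sub_bnd (subgP u)).
Definition slact (x : S0) (u : S1) : S1 := Subg (sub_lact (subgP x) (subgP u)).

Lemma sbndM : {morph sbnd : u v / u * v}.
Proof. by move=> u v; apply: val_inj; rewrite /= bndM. Qed.
Lemma slact1 u : slact 1 u = u.
Proof. by apply: val_inj; rewrite /= lact1. Qed.
Lemma slactM x y u : slact (x * y) u = slact x (slact y u).
Proof. by apply: val_inj; rewrite /= lactM. Qed.
Lemma slact_morph x : {morph slact x : u v / u * v}.
Proof. by move=> u v; apply: val_inj; rewrite /= lact_morph. Qed.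
Lemma sbnd_slact x u : sbnd (slact x u) = x * sbnd u * x^-1.
Proof. by apply: val_inj; rewrite /= bnd_lact. Qed.
Lemma slact_sbnd u v : slact (sbnd u) v = u * v * u^-1.
Proof. by apply: val_inj; rewrite /= lact_bnd. Qed.

Definition sub_crossed_module : crossed_module :=
  CrossedModule sbndM slact1 slactM slact_morph sbnd_slact slact_sbnd.

End SubCrossedModule.

Definition normal_subcrossed (G : crossed_module) (N : subcrossed G) : Prop :=
  [/\ sub0 N <| [set: grp0 G],
      forall x u, u \in sub1 N -> lact x u \in sub1 N
    & forall x u, x \in sub0 N -> lact x u * u^-1 \in sub1 N].

Section QuotientCrossedModule.
Variables (G : crossed_module) (N : subcrossed G).
Variable nN : normal_subcrossed N.
Local Notation Q1 := (coset_of (sub1 N)).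
Local Notation Q0 := (coset_of (sub0 N)).

(* coset_of K is 'N(K) / K, which is the full quotient because sub0 N and
   sub1 N are normal (qnorm0, qnorm1).
   repr picks a representative of a coset; qbndE and qlactE show that the
   choice does not matter. *)
Definition qbnd (u : Q1) : Q0 := coset (sub0 N) (bnd (repr u)).
Definition qlact (x : Q0) (u : Q1) : Q1 := coset (sub1 N) (lact (repr x) (repr u)).

Lemma qnorm1 u : u \in 'N(sub1 N).
Proof.
case: nN => _ n1 _; rewrite inE; apply/subsetP=> _ /imsetP[v Nv ->].
by rewrite conjgE -{2}[u]invgK mulgA -lact_bnd n1.
Qed.
Lemma qnorm0 x : x \in 'N(sub0 N).
Proof. by case: nN => /andP[_ /subsetP-> //]; rewrite inE. Qed.

Lemma coset_eq1 u v : u * v^-1 \in sub1 N -> coset (sub1 N) u = coset (sub1 N) v.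
Proof. by move=> uv; apply/rcoset_kercosetP; rewrite ?qnorm1 // mem_rcoset. Qed.
Lemma coset_eq0 x y : x * y^-1 \in sub0 N -> coset (sub0 N) x = coset (sub0 N) y.
Proof. by move=> xy; apply/rcoset_kercosetP; rewrite ?qnorm0 // mem_rcoset. Qed.

Lemma repr_cosetE1 u : repr (coset (sub1 N) u) * u^-1 \in sub1 N.
Proof.
by rewrite -mem_rcoset -val_coset ?qnorm1 //; apply: mem_repr_coset.
Qed.
Lemma repr_cosetE0 x : repr (coset (sub0 N) x) * x^-1 \in sub0 N.
Proof.
by rewrite -mem_rcoset -val_coset ?qnorm0 //; apply: mem_repr_coset.
Qed.

Lemma qbndE u : qbnd (coset (sub1 N) u) = coset (sub0 N) (bnd u).
Proof.
by apply: coset_eq0; rewrite -bndV -bndM; apply/sub_bnd/repr_cosetE1.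
Qed.

Lemma qlactE x u :
  qlact (coset (sub0 N) x) (coset (sub1 N) u) = coset (sub1 N) (lact x u).
Proof.
rewrite /qlact; set x' := repr _; set u' := repr _.
have Nx : x' * x^-1 \in sub0 N by apply: repr_cosetE0.
have Nu : u' * u^-1 \in sub1 N by apply: repr_cosetE1.
case: nN => _ n1 n2.
transitivity (coset (sub1 N) (lact x u')).
  apply: coset_eq1; rewrite -[x'](mulgKV x) lactM; exact: n2.
by apply: coset_eq1; rewrite -lactV -lact_morph n1.
Qed.

Lemma coset_surj1 (P : Q1 -> Prop) : (forall u, P (coset (sub1 N) u)) -> forall q, P q.
Proof. by move=> Pc q; rewrite -[q]coset_reprK. Qed.
Lemma coset_surj0 (P : Q0 -> Prop) : (forall u, P (coset (sub0 N) u)) -> forall q, P q.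
Proof. by move=> Pc q; rewrite -[q]coset_reprK. Qed.

Lemma cosetM1 u v : coset (sub1 N) u * coset (sub1 N) v = coset (sub1 N) (u * v).
Proof. by rewrite -morphM ?qnorm1. Qed.
Lemma cosetM0 x y : coset (sub0 N) x * coset (sub0 N) y = coset (sub0 N) (x * y).
Proof. by rewrite -morphM ?qnorm0. Qed.
Lemma cosetV1 u : (coset (sub1 N) u)^-1 = coset (sub1 N) u^-1.
Proof. by rewrite -morphV ?qnorm1. Qed.
Lemma cosetV0 x : (coset (sub0 N) x)^-1 = coset (sub0 N) x^-1.
Proof. by rewrite -morphV ?qnorm0. Qed.

Lemma qbndM : {morph qbnd : u v / u * v}.
Proof.
elim/coset_surj1=> u; elim/coset_surj1=> v.
by rewrite cosetM1 !qbndE cosetM0 bndM.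
Qed.
Lemma qlact1 u : qlact 1 u = u.
Proof. by elim/coset_surj1: u => u; rewrite -(coset_id (group1 _)) qlactE lact1. Qed.
Lemma qlactM x y u : qlact (x * y) u = qlact x (qlact y u).
Proof.
elim/coset_surj0: x => x; elim/coset_surj0: y => y; elim/coset_surj1: u => u.
by rewrite cosetM0 !qlactE lactM.
Qed.
Lemma qlact_morph x : {morph qlact x : u v / u * v}.
Proof.
elim/coset_surj0: x => x; elim/coset_surj1=> u; elim/coset_surj1=> v.
by rewrite cosetM1 !qlactE cosetM1 lact_morph.
Qed.
Lemma qbnd_qlact x u : qbnd (qlact x u) = x * qbnd u * x^-1.
Proof.
elim/coset_surj0: x => x; elim/coset_surj1: u => u.
by rewrite qlactE !qbndE cosetV0 !cosetM0 bnd_lact.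
Qed.
Lemma qlact_qbnd u v : qlact (qbnd u) v = u * v * u^-1.
Proof.
elim/coset_surj1: u => u; elim/coset_surj1: v => v.
by rewrite qbndE qlactE cosetV1 !cosetM1 lact_bnd.
Qed.

Definition quotient_crossed_module : crossed_module :=
  CrossedModule qbndM qlact1 qlactM qlact_morph qbnd_qlact qlact_qbnd.

End QuotientCrossedModule.

Section Center.
Variable G : crossed_module.

Definition fix_set : {set grp1 G} := [set u | [forall x, lact x u == u]].
Definition stab_set : {set grp0 G} := [set x | [forall u, lact x u == u]].

Lemma fixP u : reflect (forall x, lact x u = u) (u \in fix_set).
Proof. by rewrite inE; apply: (iffP forallP) => fu x; apply/eqP. Qed.
Lemma stabP x : reflect (forall u, lact x u = u) (x \in stab_set).
Proof. by rewrite inE; apply: (iffP forallP) => fu u; apply/eqP. Qed.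

Lemma fix_group_set : group_set fix_set.
Proof.
apply/group_setP; split=> [|u v /fixP fu /fixP fv]; apply/fixP=> x.
  by rewrite lactg1.
by rewrite lact_morph fu fv.
Qed.
Canonical fix_group := Group fix_group_set.

Lemma stab_group_set : group_set stab_set.
Proof.
apply/group_setP; split=> [|x y /stabP fx /stabP fy]; apply/stabP=> u.
  by rewrite lact1.
by rewrite lactM fy fx.
Qed.
Canonical stab_group := Group stab_group_set.

Definition center0 : {group grp0 G} := (stab_set :&: 'Z([set: grp0 G]))%G.

Lemma center_bnd u : u \in fix_group -> bnd u \in center0.
Proof.
move/fixP=> fu; rewrite inE; apply/andP; split.
  by apply/stabP=> v; rewrite lact_bnd -{1}(fu (bnd v)) lact_bnd mulgKV mulgK.
apply/centerP; split=> [|x _]; first exact: in_setT.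
by rewrite /commute -{1}(fu x) bnd_lact mulgKV.
Qed.
Lemma center_lact x u : x \in center0 -> u \in fix_group -> lact x u \in fix_group.
Proof. by move=> _ /fixP fu; rewrite fu; apply/fixP. Qed.

Definition center_sub : subcrossed G := Subcrossed center_bnd center_lact.

Lemma center_normal : normal_subcrossed center_sub.
Proof.
split=> [|x u /fixP fu|x u].
- apply/normalP; split=> [|x _]; first exact: subsetT.
  apply/normP; apply: (subsetP (cent_sub _)); apply/centP=> y.
  by case/setIP=> _ /centerP[_ cy]; apply/esym/cy; rewrite inE.
- by rewrite fu; apply/fixP.
- by case/setIP=> /stabP-> _; rewrite mulgV group1.
Qed.

Definition mod_center : crossed_module := quotient_crossed_module center_normal.

End Center.

Section Commutator.
Variable G : crossed_module.

Definition disp_set : {set grp1 G} := [set lact x u * u^-1 | x : grp0 G, u : grp1 G].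

Definition disp_group : {group grp1 G} := <<disp_set>>%G.
Definition comm_group : {group grp0 G} := [~: [set: grp0 G], [set: grp0 G]]%G.

Lemma mem_disp x u : lact x u * u^-1 \in disp_group.
Proof. by apply/mem_gen/imset2P; exists x u. Qed.

(* [~ _, _] is x^-1 * y^-1 * x * y in the library. *)
Lemma mem_comm (x y : grp0 G) : x * y * x^-1 * y^-1 \in comm_group.
Proof.
have -> : x * y * x^-1 * y^-1 = [~ x^-1, y^-1].
  by rewrite commgEl conjgE !invgK !mulgA.
by rewrite mem_commg ?inE.
Qed.

Lemma comm_bnd u : u \in disp_group -> bnd u \in comm_group.
Proof.
pose A := [set v : grp1 G | bnd v \in comm_group].
have gA : group_set A.
  apply/group_setP; split=> [|v w]; rewrite !inE ?bnd1 ?group1 // bndM.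
  exact: groupM.
suff /subsetP sA : disp_group \subset Group gA by move/sA; rewrite inE.
rewrite gen_subG; apply/subsetP=> _ /imset2P[x v _ _ ->].
by rewrite inE bndM bnd_lact bndV mem_comm.
Qed.
Lemma comm_lact x u : x \in comm_group -> u \in disp_group -> lact x u \in disp_group.
Proof. by move=> _ Du; rewrite -[lact x u](mulgKV u) groupM ?mem_disp. Qed.

Definition comm_sub : subcrossed G := Subcrossed comm_bnd comm_lact.

Definition comm_module : crossed_module := sub_crossed_module comm_sub.

(* Well-definedness on cosets is c1E and c0E below. *)
Definition c1 (u : grp1 (mod_center G)) (x : grp0 (mod_center G)) : grp1 comm_module :=
  Subg (mem_disp (repr x) (repr u)).

Definition c0 (x y : grp0 (mod_center G)) : grp0 comm_module :=
  Subg (mem_comm (repr x) (repr y)).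

Lemma c1E u x :
  sgval (c1 (coset (fix_group G) u) (coset (center0 G) x)) = lact x u * u^-1.
Proof.
have /fixP Nu := repr_cosetE1 (center_normal G) u.
have /setIP[/stabP Nx _] := repr_cosetE0 (center_normal G) x.
rewrite /c1 /=; set x' := repr _ in Nx *; set u' := repr _ in Nu *.
rewrite -[x'](mulgKV x) lactM Nx -[u'](mulgKV u); move: (u' * _) Nu => z Nz.
have com w : z * w = w * z by rewrite -{1}(Nz (bnd w)) lact_bnd mulgKV.
by rewrite lact_morph Nz !com invMg -!mulgA mulKVg.
Qed.

Lemma c0E x y :
  sgval (c0 (coset (center0 G) x) (coset (center0 G) y)) = x * y * x^-1 * y^-1.
Proof.
have /setIP[_ /centerP[_ Nx]] := repr_cosetE0 (center_normal G) x.
have /setIP[_ /centerP[_ Ny]] := repr_cosetE0 (center_normal G) y.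
rewrite /c0 /=; set x' := repr _ in Nx *; set y' := repr _ in Ny *.
rewrite -[x'](mulgKV x) -[y'](mulgKV y).
move: (x' * _) (y' * _) Nx Ny => a b Nx Ny.
have ca w : a * w = w * a by apply: Nx; rewrite inE.
have cb w : b * w = w * b by apply: Ny; rewrite inE.
transitivity (a * (x * (b * y) * x^-1) * a^-1 * (b * y)^-1).
  by rewrite invMg !mulgA.
rewrite ca mulgK; transitivity (b * (x * y * x^-1 * y^-1) * b^-1).
  by rewrite invMg !mulgA (cb x).
by rewrite cb mulgK.
Qed.

End Commutator.

Definition isoclinic (G H : crossed_module) : Prop :=
  exists (eta1 : grp1 (mod_center G) -> grp1 (mod_center H))
         (eta0 : grp0 (mod_center G) -> grp0 (mod_center H))
         (xi1 : grp1 (comm_module G) -> grp1 (comm_module H))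
         (xi0 : grp0 (comm_module G) -> grp0 (comm_module H)),
  [/\ crossed_iso eta1 eta0, crossed_iso xi1 xi0,
      forall u x, xi1 (c1 u x) = c1 (eta1 u) (eta0 x)
    & forall x y, xi0 (c0 x y) = c0 (eta0 x) (eta0 y)].

Section Automorphisms.
Variable G : crossed_module.

(* The product a * b below is the composite "b, then a"; the library's product
   of permutations composes the other way round. *)
Record aut := Aut {
  aut_val : {perm grp1 G} * {perm grp0 G};
  _ : crossed_morphism aut_val.1 aut_val.2
}.

HB.instance Definition _ := [isSub for aut_val].
HB.instance Definition _ := [Finite of aut by <:].

Definition aut1 (a : aut) : grp1 G -> grp1 G := (aut_val a).1.
Definition aut0 (a : aut) : grp0 G -> grp0 G := (aut_val a).2.

Lemma autP (a : aut) :
  [/\ {morph aut1 a : u v / u * v}, {morph aut0 a : x y / x * y},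
      forall u, aut0 a (bnd u) = bnd (aut1 a u)
    & forall x u, aut1 a (lact x u) = lact (aut0 a x) (aut1 a u)].
Proof. by case: a => a pa; apply/crossed_morphismP. Qed.

Lemma aut_ext (a b : aut) : aut1 a =1 aut1 b -> aut0 a =1 aut0 b -> a = b.
Proof.
move=> e1 e0; apply: val_inj; case: a b e1 e0 => [[a1 a0] ?] [[b1 b0] ?] e1 e0 /=.
by congr pair; apply/permP.
Qed.

Lemma aut_one_subproof : crossed_morphism (1 : {perm grp1 G}) (1 : {perm grp0 G}).
Proof. by apply/crossed_morphismP; split=> [u v|x y|u|x u]; rewrite !perm1. Qed.
Definition aut_one : aut := @Aut (1, 1) aut_one_subproof.

Lemma aut_mul_subproof (a b : aut) :
  crossed_morphism ((aut_val b).1 * (aut_val a).1) ((aut_val b).2 * (aut_val a).2).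
Proof.
have [a1 a2 a3 a4] := autP a; have [b1 b2 b3 b4] := autP b.
apply/crossed_morphismP; split=> [u v|x y|u|x u]; rewrite !permM.
- by rewrite [(aut_val b).1 _]b1 [LHS]a1.
- by rewrite [(aut_val b).2 _]b2 [LHS]a2.
- by rewrite [(aut_val b).2 _]b3 [LHS]a3.
- by rewrite [(aut_val b).1 _]b4 [LHS]a4.
Qed.
Definition aut_mul (a b : aut) : aut :=
  @Aut ((aut_val b).1 * (aut_val a).1, (aut_val b).2 * (aut_val a).2)
       (aut_mul_subproof a b).

Lemma aut_inv_subproof (a : aut) :
  crossed_morphism (aut_val a).1^-1 (aut_val a).2^-1.
Proof.
have [a1 a2 a3 a4] := autP a.
apply/crossed_morphismP; split=> [u v|x y|u|x u].
- by apply: (@perm_inj _ (aut_val a).1); rewrite permKV [RHS]a1 /aut1 !permKV.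
- by apply: (@perm_inj _ (aut_val a).2); rewrite permKV [RHS]a2 /aut0 !permKV.
- by apply: (@perm_inj _ (aut_val a).2); rewrite permKV [RHS]a3 /aut1 !permKV.
- by apply: (@perm_inj _ (aut_val a).1); rewrite permKV [RHS]a4 /aut0 /aut1 !permKV.
Qed.
Definition aut_inv (a : aut) : aut :=
  @Aut ((aut_val a).1^-1, (aut_val a).2^-1) (aut_inv_subproof a).

Lemma aut_mulA : associative aut_mul.
Proof. by move=> a b c; apply: val_inj; rewrite /= !mulgA. Qed.
Lemma aut_mul1 : left_id aut_one aut_mul.
Proof. by move=> a; apply: val_inj; rewrite /= !mulg1 -surjective_pairing. Qed.
Lemma aut_mulV : left_inverse aut_one aut_inv aut_mul.
Proof. by move=> a; apply: val_inj; rewrite /= !mulgV. Qed.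

HB.instance Definition _ := Finite_isGroup.Build aut aut_mulA aut_mul1 aut_mulV.

Lemma aut1M (a b : aut) u : aut1 (a * b) u = aut1 a (aut1 b u).
Proof. exact: permM. Qed.
Lemma aut0M (a b : aut) x : aut0 (a * b) x = aut0 a (aut0 b x).
Proof. exact: permM. Qed.
Lemma aut1_1 u : aut1 (1 : aut) u = u.
Proof. exact: perm1. Qed.
Lemma aut0_1 x : aut0 (1 : aut) x = x.
Proof. exact: perm1. Qed.
Lemma aut1K (a : aut) : cancel (aut1 a) (aut1 a^-1).
Proof. by move=> u; rewrite -aut1M mulVg aut1_1. Qed.
Lemma aut0K (a : aut) : cancel (aut0 a) (aut0 a^-1).
Proof. by move=> u; rewrite -aut0M mulVg aut0_1. Qed.
Lemma aut1KV (a : aut) : cancel (aut1 a^-1) (aut1 a).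
Proof. by move=> u; rewrite -aut1M mulgV aut1_1. Qed.
Lemma aut0KV (a : aut) : cancel (aut0 a^-1) (aut0 a).
Proof. by move=> u; rewrite -aut0M mulgV aut0_1. Qed.

End Automorphisms.

Section Derivations.
Variable G : crossed_module.

Record derivation := Derivation {
  der_val : {ffun grp0 G -> grp1 G};
  _ : [forall x, forall y, der_val (x * y) == der_val x * lact x (der_val y)]
}.

HB.instance Definition _ := [isSub for der_val].
HB.instance Definition _ := [Finite of derivation by <:].

Definition der_fun (p : derivation) : grp0 G -> grp1 G := der_val p.
Coercion der_fun : derivation >-> Funclass.

Lemma derM (p : derivation) x y : p (x * y) = p x * lact x (p y).
Proof. by case: p => f pf; apply/eqP/(forallP (forallP pf x)). Qed.

Lemma der_ext (p q : derivation) : p =1 q -> p = q.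
Proof. by move=> pq; apply/val_inj/ffunP. Qed.

Section Mk.
Variables (f : grp0 G -> grp1 G) (fM : forall x y, f (x * y) = f x * lact x (f y)).
Lemma mk_der_subproof :
  [forall x, forall y, finfun f (x * y) == finfun f x * lact x (finfun f y)].
Proof. by apply/forallP=> x; apply/forallP=> y; rewrite !ffunE fM. Qed.
Definition mk_der : derivation := Derivation mk_der_subproof.
Lemma mk_derE x : mk_der x = f x.
Proof. by rewrite /mk_der /der_fun /= ffunE. Qed.
End Mk.

Lemma der_one_subproof (x y : grp0 G) : 1 = 1 * lact x 1 :> grp1 G.
Proof. by rewrite lactg1 mulg1. Qed.
Definition der_one : derivation := @mk_der (fun=> 1) der_one_subproof.

Lemma der_shift (p : derivation) x y : bnd (p (x * y)) * (x * y) =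
  (bnd (p x) * x) * (bnd (p y) * y).
Proof. by rewrite derM bndM bnd_lact !mulgA mulgKV. Qed.

Lemma der_mul_subproof (p q : derivation) x y :
  p (bnd (q (x * y)) * (x * y)) * q (x * y) =
  p (bnd (q x) * x) * q x * lact x (p (bnd (q y) * y) * q y).
Proof.
rewrite der_shift derM (derM q) lactM lact_bnd lact_morph !mulgA.
by rewrite mulgKV.
Qed.
Definition der_mul (p q : derivation) : derivation := mk_der (der_mul_subproof p q).

Lemma der_mulE p q x : der_mul p q x = p (bnd (q x) * x) * q x.
Proof. exact: mk_derE. Qed.

Lemma der_mulA : associative der_mul.
Proof. by move=> p q r; apply: der_ext => x; rewrite !der_mulE bndM !mulgA. Qed.
Lemma der_mul1 : left_id der_one der_mul.
Proof. by move=> p; apply: der_ext => x; rewrite der_mulE mk_derE mul1g. Qed.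
Lemma der_mulr1 : right_id der_one der_mul.
Proof.
by move=> p; apply: der_ext => x; rewrite der_mulE mk_derE bnd1 mul1g mulg1.
Qed.

Record whitehead := Whitehead {
  wh_val : derivation;
  _ : [exists q, (der_mul wh_val q == der_one) && (der_mul q wh_val == der_one)]
}.

HB.instance Definition _ := [isSub for wh_val].
HB.instance Definition _ := [Finite of whitehead by <:].

Lemma whP (p : whitehead) :
  exists q, (der_mul (wh_val p) q == der_one) && (der_mul q (wh_val p) == der_one).
Proof. exact/existsP/(valP p). Qed.

Section MkWh.
Variables (p q : derivation).
Hypotheses (pq : der_mul p q = der_one) (qp : der_mul q p = der_one).
Lemma mk_wh_subproof :
  [exists q, (der_mul p q == der_one) && (der_mul q p == der_one)].
Proof. by apply/existsP; exists q; rewrite pq qp !eqxx. Qed.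
Definition mk_wh : whitehead := Whitehead mk_wh_subproof.
End MkWh.

Lemma wh_one_subproof : der_mul der_one der_one = der_one.
Proof. exact: der_mul1. Qed.
Definition wh_one : whitehead := mk_wh wh_one_subproof wh_one_subproof.

Lemma wh_mul_subproof (p q : whitehead) :
  [exists r, (der_mul (der_mul (wh_val p) (wh_val q)) r == der_one)
          && (der_mul r (der_mul (wh_val p) (wh_val q)) == der_one)].
Proof.
have [p' /andP[/eqP pp' /eqP p'p]] := whP p.
have [q' /andP[/eqP qq' /eqP q'q]] := whP q.
apply/existsP; exists (der_mul q' p'); apply/andP; split; apply/eqP.
  by rewrite der_mulA -(der_mulA _ _ q') qq' der_mulr1.
by rewrite der_mulA -(der_mulA q') p'p der_mulr1.
Qed.
Definition wh_mul (p q : whitehead) : whitehead := Whitehead (wh_mul_subproof p q).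

Lemma wh_inv_subproof (p : whitehead) :
  [exists q, (der_mul (xchoose (whP p)) q == der_one)
          && (der_mul q (xchoose (whP p)) == der_one)].
Proof. by apply/existsP; exists (wh_val p); rewrite andbC; apply: (xchooseP (whP p)). Qed.
Definition wh_inv (p : whitehead) : whitehead := Whitehead (wh_inv_subproof p).

Lemma wh_mulA : associative wh_mul.
Proof. by move=> p q r; apply: val_inj; apply: der_mulA. Qed.
Lemma wh_mul1 : left_id wh_one wh_mul.
Proof. by move=> p; apply: val_inj; apply: der_mul1. Qed.
Lemma wh_mulV : left_inverse wh_one wh_inv wh_mul.
Proof.
move=> p; have /andP[_ /eqP qp] := xchooseP (whP p).
exact: val_inj.
Qed.

HB.instance Definition _ := Finite_isGroup.Build whitehead wh_mulA wh_mul1 wh_mulV.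

Definition wh_fun (p : whitehead) : grp0 G -> grp1 G := wh_val p.
Coercion wh_fun : whitehead >-> Funclass.

Lemma whM (p : whitehead) x y : p (x * y) = p x * lact x (p y).
Proof. exact: derM. Qed.
Lemma wh_ext (p q : whitehead) : p =1 q -> p = q.
Proof. by move=> pq; apply/val_inj/der_ext. Qed.
Lemma wh_mulE (p q : whitehead) x : (p * q) x = p (bnd (q x) * x) * q x.
Proof. exact: der_mulE. Qed.
Lemma wh1E x : (1 : whitehead) x = 1.
Proof. exact: mk_derE. Qed.
Lemma wh_1 (p : whitehead) : p 1 = 1.
Proof. by apply: (mulgI (p 1)); rewrite -{2}(lact1 (p 1)) -whM !mulg1. Qed.

Definition delta1 (p : whitehead) (u : grp1 G) : grp1 G := p (bnd u) * u.
Definition delta0 (p : whitehead) (x : grp0 G) : grp0 G := bnd (p x) * x.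

Lemma delta0M p q x : delta0 (p * q) x = delta0 p (delta0 q x).
Proof. by rewrite /delta0 wh_mulE bndM mulgA. Qed.
Lemma delta1M p q u : delta1 (p * q) u = delta1 p (delta1 q u).
Proof. by rewrite /delta1 wh_mulE bndM mulgA. Qed.
Lemma delta0_1 x : delta0 1 x = x.
Proof. by rewrite /delta0 wh1E bnd1 mul1g. Qed.
Lemma delta1_1 u : delta1 1 u = u.
Proof. by rewrite /delta1 wh1E mul1g. Qed.

Lemma delta0_inj p : injective (delta0 p).
Proof. by apply: (@can_inj _ _ _ (delta0 p^-1)) => x; rewrite -delta0M mulVg delta0_1. Qed.
Lemma delta1_inj p : injective (delta1 p).
Proof. by apply: (@can_inj _ _ _ (delta1 p^-1)) => x; rewrite -delta1M mulVg delta1_1. Qed.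

Lemma delta_morphism p :
  crossed_morphism (perm (@delta1_inj p)) (perm (@delta0_inj p)).
Proof.
apply/crossed_morphismP; split=> [u v|x y|u|x u]; rewrite !permE /delta1 /delta0.
- by rewrite bndM whM lact_bnd !mulgA mulgKV.
- exact: der_shift.
- by rewrite bndM.
- have pV : lact x (p x^-1) = (p x)^-1.
    by apply: (mulgI (p x)); rewrite -whM !mulgV wh_1.
  rewrite lactM lact_bnd bnd_lact 2!whM.
  rewrite -[x * bnd u](mulgKV x) lactM -bnd_lact pV lact_bnd lact_morph.
  by rewrite !mulgA mulgKV.
Qed.
Definition delta (p : whitehead) : aut G :=
  @Aut G (perm (@delta1_inj p), perm (@delta0_inj p)) (delta_morphism p).

Definition wh_conj_fun (a : aut G) (p : whitehead) (x : grp0 G) : grp1 G :=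
  aut1 a (p (aut0 a^-1 x)).

Lemma der_conj_subproof (a : aut G) (p : derivation) x y :
  aut1 a (p (aut0 a^-1 (x * y))) =
  aut1 a (p (aut0 a^-1 x)) * lact x (aut1 a (p (aut0 a^-1 y))).
Proof.
have [a1 _ _ a4] := autP a; have [_ b2 _ _] := autP a^-1.
by rewrite b2 derM a1 a4 aut0KV.
Qed.
Definition der_conj (a : aut G) (p : derivation) : derivation :=
  mk_der (der_conj_subproof a p).

Lemma der_conjE a p x : der_conj a p x = aut1 a (p (aut0 a^-1 x)).
Proof. exact: mk_derE. Qed.

Lemma der_conjM a p q : der_conj a (der_mul p q) = der_mul (der_conj a p) (der_conj a q).
Proof.
have [a1 _ a3 _] := autP a; have [_ b2 _ _] := autP a^-1.
apply: der_ext => x; rewrite der_mulE !der_conjE der_mulE a1 b2; congr (aut1 _ (p (_ * _)) * _).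
by rewrite -a3 aut0K.
Qed.
Lemma der_conj1 a : der_conj a der_one = der_one.
Proof.
have [a1 _ _ _] := autP a.
apply: der_ext => x; rewrite der_conjE !mk_derE.
by apply: (mulgI (aut1 a 1)); rewrite -a1 !mulg1.
Qed.

Lemma wh_conj_subproof (a : aut G) (p : whitehead) :
  [exists q, (der_mul (der_conj a (wh_val p)) q == der_one)
          && (der_mul q (der_conj a (wh_val p)) == der_one)].
Proof.
have [q /andP[/eqP pq /eqP qp]] := whP p.
by apply/existsP; exists (der_conj a q); rewrite -!der_conjM pq qp der_conj1 !eqxx.
Qed.
Definition wh_conj (a : aut G) (p : whitehead) : whitehead :=
  Whitehead (wh_conj_subproof a p).

Lemma wh_conjE a (p : whitehead) x : wh_conj a p x = aut1 a (p (aut0 a^-1 x)).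
Proof. exact: der_conjE. Qed.

End Derivations.

Section Actor.
Variable G : crossed_module.
Implicit Types (a b : aut G) (p q : whitehead G).

Lemma aut1_delta p u : aut1 (delta p) u = p (bnd u) * u.
Proof. by rewrite /aut1 /= permE. Qed.
Lemma aut0_delta p x : aut0 (delta p) x = bnd (p x) * x.
Proof. by rewrite /aut0 /= permE. Qed.

Lemma deltaM : {morph @delta G : p q / p * q}.
Proof.
move=> p q; apply: aut_ext => [u|x].
  by rewrite aut1M !aut1_delta -[LHS]/(delta1 (p * q) u) delta1M.
by rewrite aut0M !aut0_delta -[LHS]/(delta0 (p * q) x) delta0M.
Qed.
Lemma wh_conj_1 p : wh_conj 1 p = p.
Proof. by apply: wh_ext => x; rewrite wh_conjE invg1 aut0_1 aut1_1. Qed.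
Lemma wh_conjM a b p : wh_conj (a * b) p = wh_conj a (wh_conj b p).
Proof. by apply: wh_ext => x; rewrite !wh_conjE invMg aut0M aut1M. Qed.
Lemma wh_conj_morph a : {morph wh_conj a : p q / p * q}.
Proof. by move=> p q; apply: val_inj; apply: der_conjM. Qed.
Lemma delta_conj a p : delta (wh_conj a p) = a * delta p * a^-1.
Proof.
have [a1 a2 a3 _] := autP a; have [_ _ b3 _] := autP a^-1.
apply: aut_ext => [u|x].
  by rewrite !aut1M !aut1_delta wh_conjE a1 aut1KV b3.
by rewrite !aut0M !aut0_delta wh_conjE a2 aut0KV a3.
Qed.
Lemma conj_delta p q : wh_conj (delta p) q = p * q * p^-1.
Proof.
apply: (mulIg p); rewrite mulgKV; apply: wh_ext => x.
rewrite !wh_mulE wh_conjE aut1_delta -aut0_delta aut0K.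
by rewrite whM lact_bnd !mulgA mulgKV.
Qed.

Definition actor : crossed_module :=
  CrossedModule deltaM wh_conj_1 wh_conjM wh_conj_morph delta_conj conj_delta.

(* The witness is uniform: one u for all x, one x for all u and y. *)
Definition cp_der_set : {set whitehead G} :=
  [set p : whitehead G | [exists u, forall x, p x == u * lact x u^-1]].
Definition cp_aut_set : {set aut G} :=
  [set a : aut G | [exists x, [forall u, aut1 a u == lact x u]
                           && [forall y, aut0 a y == x * y * x^-1]]].

Lemma cp_derP p :
  reflect (exists u, forall x, p x = u * lact x u^-1) (p \in cp_der_set).
Proof.
rewrite inE; apply: (iffP existsP) => -[u pu]; exists u.
  by move=> x; apply/eqP/(forallP pu).
by apply/forallP=> x; rewrite pu.
Qed.
Lemma cp_autP a :
  reflect (exists x, (forall u, aut1 a u = lact x u)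
                  /\ (forall y, aut0 a y = x * y * x^-1)) (a \in cp_aut_set).
Proof.
rewrite inE; apply: (iffP existsP) => -[x].
  by case/andP=> /forallP e1 /forallP e0; exists x; split=> z; apply/eqP.
by case=> e1 e0; exists x; apply/andP; split; apply/forallP=> z; rewrite ?e1 ?e0.
Qed.

Lemma cp_der_group_set : group_set cp_der_set.
Proof.
apply/group_setP; split=> [|p q /cp_derP[u pu] /cp_derP[v qv]]; apply/cp_derP.
  by exists 1 => x; rewrite wh1E invg1 lactg1 mulg1.
exists (u * v) => x; rewrite wh_mulE whM lact_bnd -mulgA mulgKV.
by rewrite !pu lact_bnd !mulgA !mulgKV qv invMg lact_morph !mulgA.
Qed.
Canonical cp_der_group := Group cp_der_group_set.

Lemma cp_aut_group_set : group_set cp_aut_set.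
Proof.
apply/group_setP; split=> [|a b /cp_autP[x [a1 a0]] /cp_autP[y [b1 b0]]].
  apply/cp_autP; exists 1; split=> [u|y]; first by rewrite aut1_1 lact1.
  by rewrite aut0_1 mul1g invg1 mulg1.
apply/cp_autP; exists (x * y); split=> [u|z]; first by rewrite aut1M b1 a1 lactM.
by rewrite aut0M b0 a0 invMg !mulgA.
Qed.
Canonical cp_aut_group := Group cp_aut_group_set.

Lemma cp_bnd (p : grp1 actor) : p \in cp_der_group -> bnd p \in cp_aut_group.
Proof.
case/cp_derP=> u pu; apply/cp_autP; exists (bnd u); split=> [v|x].
  by rewrite aut1_delta pu !lact_bnd -!mulgA mulVg mulg1.
by rewrite aut0_delta pu bndM bnd_lact bndV !mulgA mulgKV.
Qed.
Lemma cp_lact (a : grp0 actor) (p : grp1 actor) :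
  a \in cp_aut_group -> p \in cp_der_group -> lact a p \in cp_der_group.
Proof.
move=> _ /cp_derP[u pu]; apply/cp_derP; exists (aut1 a u) => x.
have [a1 _ _ a4] := autP a.
rewrite wh_conjE pu a1 a4 aut0KV; congr (_ * lact _ _).
by apply: (mulgI (aut1 a u)); rewrite -a1 !mulgV; apply: (mulgI (aut1 a 1)); rewrite -a1 !mulg1.
Qed.

Definition cp_actor : crossed_module :=
  sub_crossed_module (Subcrossed cp_bnd cp_lact).

End Actor.

(* Main.v *)
Require Import Defs.
From mathcomp Require Import all_boot all_fingroup.
From mathcomp Require Import center.

(** The class preserving actor sees only the quotient by the centre: it is
    isomorphic to [G/Z(G)], and an isoclinism contains an isomorphism of the
    central quotients.

    An element [u] of [G_1] yields the derivation [x |-> u * (^x u)^-1], and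
    an element [x] of [G_0] yields the automorphism acting by [x] on [G_1] and
    by conjugation on [G_0].  By definition the class preserving derivations
    and automorphisms are exactly these, and both assignments are group
    homomorphisms, compatible with the boundaries and the actions.  Two
    elements [u], [v] give the same derivation iff [u^-1 * v] is fixed by
    [G_0]; two elements [x], [y] give the same automorphism iff [x^-1 * y] acts
    trivially on [G_1] and is central in [G_0].  Hence the kernels are the two
    components of [Z(G)] ([inner_der_eq], [inner_aut_eq]), and the first
    isomorphism theorem gives [mod_center_cp_actor]. *)

Set Implicit Arguments.
Unset Strict Implicit.
Unset Printing Implicit Defensive.

Local Open Scope group_scope.

Lemma inj_surj_bij (S T : finType) (f : S -> T) :
  injective f -> (forall y, exists x, f x = y) -> bijective f.
Proof.
move=> inj_f surj_f; apply: inj_card_bij => //.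
rewrite -(card_codom inj_f); apply/subset_leq_card/subsetP=> y _.
by have [x <-] := surj_f y; apply: codom_f.
Qed.

Lemma isomorphic_trans (G H K : crossed_module) :
  isomorphic G H -> isomorphic H K -> isomorphic G K.
Proof.
case=> f1 [f0 [/crossed_morphismP[m1 m0 fd fa] bf1 bf0]].
case=> g1 [g0 [/crossed_morphismP[n1 n0 gd ga] bg1 bg0]].
exists (g1 \o f1), (g0 \o f0); split; try exact: bij_comp.
by apply/crossed_morphismP; split=> [u v|x y|u|x u] /=;
  rewrite ?m1 ?n1 ?m0 ?n0 ?fd ?gd ?fa ?ga.
Qed.

Lemma isomorphic_sym (G H : crossed_module) :
  isomorphic G H -> isomorphic H G.
Proof.
case=> f1 [f0 [/crossed_morphismP[m1 m0 fd fa] bf1 bf0]].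
have [g1 fK1 gK1] := bf1; have [g0 fK0 gK0] := bf0.
exists g1, g0; split; [|by exists f1|by exists f0].
apply/crossed_morphismP; split=> [u v|x y|u|x u].
- by rewrite -{1}(gK1 u) -{1}(gK1 v) -m1 fK1.
- by rewrite -{1}(gK0 x) -{1}(gK0 y) -m0 fK0.
- by rewrite -{1}(gK1 u) -fd fK0.
- by rewrite -{1}(gK0 x) -{1}(gK1 u) -fa fK1.
Qed.

(** * Inner derivations *)

Section InnerDerivations.
Variable G : crossed_module.
Implicit Types (u v : grp1 G) (x y : grp0 G).

Lemma inner_der_subproof u x y :
  u * lact (x * y) u^-1 = u * lact x u^-1 * lact x (u * lact y u^-1).
Proof. by rewrite lact_morph lactM (lactV x u) mulgA mulgKV. Qed.

Definition inner_derivation u : derivation G := mk_der (inner_der_subproof u).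

Lemma inner_derivationE u x : inner_derivation u x = u * lact x u^-1.
Proof. exact: mk_derE. Qed.

(** Together with [inner_derivation1] this is a monoid morphism out of a group,
    so its values are units: this is what places them in the Whitehead group. *)
Lemma inner_derivationM u v :
  der_mul (inner_derivation u) (inner_derivation v) = inner_derivation (u * v).
Proof.
apply: der_ext => x; rewrite der_mulE derM lact_bnd -mulgA mulgKV.
rewrite !(inner_derivationE u) lact_bnd !mulgA !mulgKV.
by rewrite !inner_derivationE invMg lact_morph !mulgA.
Qed.

Lemma inner_derivation1 : inner_derivation 1 = der_one G.
Proof.
by apply: der_ext => x; rewrite inner_derivationE mk_derE invg1 lactg1 mulg1.
Qed.

Lemma inner_derivation_mulgV u :
  der_mul (inner_derivation u) (inner_derivation u^-1) = der_one G.
Proof. by rewrite inner_derivationM mulgV inner_derivation1. Qed.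

Lemma inner_derivation_mulVg u :
  der_mul (inner_derivation u^-1) (inner_derivation u) = der_one G.
Proof. by rewrite inner_derivationM mulVg inner_derivation1. Qed.

Definition inner_wh u : whitehead G :=
  mk_wh (inner_derivation_mulgV u) (inner_derivation_mulVg u).

Lemma inner_whE u x : inner_wh u x = u * lact x u^-1.
Proof. exact: inner_derivationE. Qed.

Lemma inner_wh_cp u : inner_wh u \in cp_der_group G.
Proof. by apply/cp_derP; exists u => x; apply: inner_whE. Qed.

Definition inner_der u : grp1 (cp_actor G) := Subg (inner_wh_cp u).

Lemma inner_derM : {morph inner_der : u v / u * v}.
Proof.
by move=> u v; do 2!apply: val_inj; rewrite /= -inner_derivationM.
Qed.

Lemma inner_der_surj p : exists u, inner_der u = p.
Proof.
have /cp_derP[u pu] := subgP p; exists u.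
by apply/val_inj/wh_ext => x; rewrite pu; apply: inner_whE.
Qed.

(** The equation [u * ^x u^-1 = v * ^x v^-1] rearranges to
    [^x (v^-1 * u) = v^-1 * u]. *)
Lemma inner_der_eq u v : inner_der u = inner_der v <-> v^-1 * u \in fix_group G.
Proof.
split=> [/(congr1 val) /= e | /fixP fuv].
  apply/fixP=> x; move/(congr1 (fun p : whitehead G => p x)): e.
  rewrite !inner_whE => e; apply: (mulgI v); rewrite mulKVg.
  by rewrite lact_morph mulgA -e -mulgA -lact_morph mulVg lactg1 mulg1.
apply/val_inj/wh_ext => x; rewrite !inner_whE.
rewrite -{1}[u](mulKVg v) -{1}(fuv x) -mulgA -lact_morph.
by rewrite -mulgA mulgV mulg1.
Qed.

End InnerDerivations.

(** * Inner automorphisms *)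

Section InnerAutomorphisms.
Variable G : crossed_module.
Implicit Types (u v : grp1 G) (x y : grp0 G).

Lemma conjl_inj x : injective (fun y => x * y * x^-1).
Proof. by move=> y z /mulIg/mulgI. Qed.

Lemma inner_aut_subproof x :
  crossed_morphism (perm (can_inj (@lactK G x))) (perm (@conjl_inj x)).
Proof.
apply/crossed_morphismP; split=> [u v|y z|u|y u]; rewrite !permE.
- exact: lact_morph.
- by rewrite !mulgA mulgKV.
- by rewrite bnd_lact.
- by rewrite !lactM lactK.
Qed.

Definition inner_automorphism x : Defs.aut G :=
  Defs.Aut (aut_val := (_, _)) (inner_aut_subproof x).

Lemma inner_automorphism1E x u : aut1 (inner_automorphism x) u = lact x u.
Proof. exact: permE. Qed.

Lemma inner_automorphism0E x y :
  aut0 (inner_automorphism x) y = x * y * x^-1.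
Proof. exact: permE. Qed.

Lemma inner_automorphism_cp x : inner_automorphism x \in cp_aut_group G.
Proof.
by apply/cp_autP; exists x; split=> z;
  rewrite (inner_automorphism1E, inner_automorphism0E).
Qed.

Definition inner_aut x : grp0 (cp_actor G) := Subg (inner_automorphism_cp x).

Lemma inner_autM : {morph inner_aut : x y / x * y}.
Proof.
move=> x y; apply/val_inj/aut_ext => z /=.
  by rewrite aut1M !inner_automorphism1E lactM.
by rewrite aut0M !inner_automorphism0E invMg !mulgA.
Qed.

Lemma inner_aut_surj a : exists x, inner_aut x = a.
Proof.
have /cp_autP[x [a1 a0]] := subgP a; exists x.
apply/val_inj/aut_ext => z /=.
  by rewrite inner_automorphism1E a1.
by rewrite inner_automorphism0E a0.
Qed.

(** Agreement on [G_1] says that [y^-1 * x] stabilizes [G_1], agreement on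
    [G_0] that it is central. *)
Lemma inner_aut_eq x y : inner_aut x = inner_aut y <-> y^-1 * x \in center0 G.
Proof.
split=> [/(congr1 val) /= e | /setIP[/stabP sxy /centerP[_ cxy]]].
  apply/setIP; split; last apply/centerP; last split=> [|z _]; rewrite ?inE //.
    apply/forallP=> u; rewrite lactM -[lact x u]inner_automorphism1E e.
    by rewrite inner_automorphism1E lactK.
  have := inner_automorphism0E x z; rewrite e inner_automorphism0E => exy.
  have xE : x * z = y * z * y^-1 * x by rewrite exy mulgKV.
  by rewrite /commute -mulgA xE !mulgA mulVg mul1g.
rewrite -[x](mulKVg y); move: (y^-1 * x) sxy cxy => c sc cc.
apply/val_inj/aut_ext => z /=.
  by rewrite !inner_automorphism1E lactM sc.
rewrite !inner_automorphism0E -(mulgA y) (cc z) ?inE //.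
by rewrite invMg !mulgA mulgK.
Qed.

Lemma inner_aut_bnd u : inner_aut (bnd u) = bnd (inner_der u).
Proof.
apply/val_inj/aut_ext => z /=.
  rewrite inner_automorphism1E aut1_delta inner_whE.
  by rewrite !lact_bnd -!mulgA mulVg mulg1.
rewrite inner_automorphism0E aut0_delta inner_whE.
by rewrite bndM bnd_lact bndV !mulgA mulgKV.
Qed.

Lemma inner_der_lact x u :
  inner_der (lact x u) = lact (inner_aut x) (inner_der u).
Proof.
apply/val_inj/wh_ext => y /=.
rewrite wh_conjE !inner_whE inner_automorphism1E lact_morph.
congr (_ * _); rewrite -[y in LHS](aut0KV (inner_automorphism x)).
by rewrite inner_automorphism0E !lactM -lactV lactK.
Qed.

End InnerAutomorphisms.

(** * The class preserving actor is the central quotient *)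

Section CentralQuotient.
Variable G : crossed_module.

Definition coset_der (q : grp1 (mod_center G)) := inner_der (repr q).
Definition coset_aut (q : grp0 (mod_center G)) := inner_aut (repr q).

(** The identities [inner_der_eq] and [inner_aut_eq] are about left quotients,
    whereas representatives of cosets differ by right quotients; normality of
    the centre is what makes the two agree. *)
Lemma coset_derE u : coset_der (coset (fix_group G) u) = inner_der u.
Proof.
apply/inner_der_eq.
have := repr_cosetE1 (Defs.center_normal G) u.
by rewrite -(memJ_norm _ (qnorm1 (Defs.center_normal G) u)) conjgE mulgKV.
Qed.

Lemma coset_autE x : coset_aut (coset (center0 G) x) = inner_aut x.
Proof.
apply/inner_aut_eq.
have := repr_cosetE0 (Defs.center_normal G) x.
by rewrite -(memJ_norm _ (qnorm0 (Defs.center_normal G) x)) conjgE mulgKV.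
Qed.

Lemma coset_der_bij : bijective coset_der.
Proof.
apply: inj_surj_bij => [|p]; last first.
  by have [u <-] := inner_der_surj p; exists (coset _ u); apply: coset_derE.
elim/coset_surj1=> u; elim/coset_surj1=> v; rewrite !coset_derE.
move/inner_der_eq=> Zuv; apply: (coset_eq1 (Defs.center_normal G)).
rewrite -(memJ_norm _ (qnorm1 (Defs.center_normal G) v)).
by rewrite conjgE mulgKV.
Qed.

Lemma coset_aut_bij : bijective coset_aut.
Proof.
apply: inj_surj_bij => [|a]; last first.
  by have [x <-] := inner_aut_surj a; exists (coset _ x); apply: coset_autE.
elim/coset_surj0=> x; elim/coset_surj0=> y; rewrite !coset_autE.
move/inner_aut_eq=> Zxy; apply: (coset_eq0 (Defs.center_normal G)).
rewrite -(memJ_norm _ (qnorm0 (Defs.center_normal G) y)).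
by rewrite conjgE mulgKV.
Qed.

Theorem mod_center_cp_actor : isomorphic (mod_center G) (cp_actor G).
Proof.
exists coset_der, coset_aut; split; first apply/crossed_morphismP.
- split.
  + elim/coset_surj1=> u; elim/coset_surj1=> v.
    by rewrite (cosetM1 (Defs.center_normal G)) !coset_derE inner_derM.
  + elim/coset_surj0=> x; elim/coset_surj0=> y.
    by rewrite (cosetM0 (Defs.center_normal G)) !coset_autE inner_autM.
  + elim/coset_surj1=> u.
    by rewrite [bnd _](qbndE (Defs.center_normal G)) coset_autE coset_derE inner_aut_bnd.
  + elim/coset_surj0=> x; elim/coset_surj1=> u.
    rewrite coset_autE (coset_derE u) -inner_der_lact -coset_derE.
    by congr coset_der; apply: (qlactE (Defs.center_normal G)).
- exact: coset_der_bij.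
- exact: coset_aut_bij.
Qed.

End CentralQuotient.

Theorem corollary32 (G H : crossed_module) (iso : isoclinic G H) :
  isomorphic (cp_actor G) (cp_actor H).
Proof.
case: iso => eta1 [eta0 [_ [_ [eta_iso _ _ _]]]].
apply: (isomorphic_trans (isomorphic_sym (mod_center_cp_actor G))).
apply: isomorphic_trans (mod_center_cp_actor H).
by exists eta1, eta0.
Qed.
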